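(* Let $S_\infty=\bigcup_{n=1}^\infty S_n$ be the infinite symmetric group. The Tsuboi metric space $(\mathcal{M}(S_\infty), d)$ is quasi-isometric to the half line $\mathbb{R}_{\ge 0}$ with the standard metric.
   Context: $S_\infty$ is the direct limit of the finite symmetric groups $S_n$ under the standard inclusions $S_n\to S_{n+1}$, i.e. the group of finitely supported permutations of $\{1,2,3,\dots\}$; $A_\infty=\bigcup_n A_n$ is its subgroup of even permutations. Tsuboi metric: let $G$ be a group having a maximum proper normal subgroup $N$ (a proper normal subgroup containing every proper normal subgroup). For $g\in G\setminus N$ and $f\in G$, $q_g(f)$ is the smallest number $k$ such that $f$ is a product of $k$ conjugates of elements of $\{g,g^{-1}\}$. Elements $f,g$ are symmetrized conjugate, $f\sim g$, if $f$ is conjugate to $g$ or $g^{-1}$; $[g]$ denotes the class of $g$. Set $\mathcal{M}(G)=(G\setminus N)/\sim$ and $d([f],[g])=\log\max\{q_g(f),q_f(g)\}$, which is a metric on $\mathcal{M}(G)$. For $G=S_\infty$ the maximum proper normal subgroup exists and equals $A_\infty$. *)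

(* Defs.v *)
From HB Require Import structures.
From mathcomp Require Import all_boot all_order all_algebra all_fingroup.
From mathcomp Require Import gseries alt.
From mathcomp Require Import all_classical all_reals all_analysis.

Set Implicit Arguments.
Unset Strict Implicit.
Unset Printing Implicit Defensive.

Import Order.TTheory GRing.Theory Num.Theory.

Local Open Scope group_scope.
Local Open Scope classical_set_scope.
Local Open Scope quotient_scope.

Record normal_subgroup (G : groupType) (N : set G) : Prop := NormalSubgroup {
  normal_subgroup1 : N 1;
  normal_subgroupM : forall x y, N x -> N y -> N (x * y);
  normal_subgroupV : forall x, N x -> N x^-1;
  normal_subgroupJ : forall x y, N x -> N (x ^ y) }.

Definition max_proper_normal_subgroup (G : groupType) (N : set G) : Prop :=
  [/\ normal_subgroup N, N <> setT &
      forall M : set G, normal_subgroup M -> M <> setT -> M `<=` N].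

HB.mixin Record hasMaxNormal G of monoid.Group G := {
  maxN : set G;
  maxNP : max_proper_normal_subgroup maxN
}.

#[short(type="maxNormalGroupType")]
HB.structure Definition MaxNormalGroup := {G of hasMaxNormal G & monoid.Group G}.

Definition symm_conj (G : groupType) (f g : G) : Prop :=
  exists h, f = g ^ h \/ f = g^-1 ^ h.

Definition prod_symm_conj (G : groupType) (g : G) (k : nat) (f : G) : Prop :=
  exists s : seq G,
    [/\ size s = k, forall x, x \in s -> symm_conj x g & f = \prod_(x <- s) x].

Section SymmConj.
Variable G : groupType.
Implicit Types f g h x y : G.

Lemma symm_conj_refl f : symm_conj f f.
Proof. by exists 1; left; rewrite conjg1. Qed.

Lemma symm_conj_sym f g : symm_conj f g -> symm_conj g f.
Proof.
case=> h [->|->]; exists h^-1; [left|right]; first by rewrite conjgK.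
by rewrite conjVg conjgK invgK.
Qed.

Lemma symm_conj_trans g f h : symm_conj f g -> symm_conj g h -> symm_conj f h.
Proof.
case=> a fg [b gh]; exists (b * a); rewrite !conjgM.
by case: fg => ->; case: gh => ->; rewrite ?conjVg ?invgK; [left|right|right|left].
Qed.

Lemma symm_conjV f g : symm_conj f g -> symm_conj f^-1 g.
Proof.
by case=> h [->|->]; exists h; [right|left]; rewrite ?conjVg ?invgK.
Qed.

Lemma symm_conjJ f g h : symm_conj f g -> symm_conj (f ^ h) g.
Proof. by case=> a [->|->]; exists (a * h); rewrite !conjgM; [left|right]. Qed.

Lemma prod_symm_conjM g k l x y : prod_symm_conj g k x ->
  prod_symm_conj g l y -> prod_symm_conj g (k + l)%N (x * y).
Proof.
move=> [s [<- sg ->]] [t [<- tg ->]]; exists (s ++ t).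
split; rewrite ?size_cat ?big_cat// => z.
by rewrite mem_cat => /orP[/sg|/tg].
Qed.

Lemma prod_symm_conjJ g k x h : prod_symm_conj g k x ->
  prod_symm_conj g k (x ^ h).
Proof.
move=> [s [<- sg ->]]; exists [seq y ^ h | y <- s].
split; rewrite ?size_map ?big_map ?conjg_prod// => _ /mapP[y ys ->].
exact/symm_conjJ/sg.
Qed.

Lemma prod_symm_conjV g k x : prod_symm_conj g k x ->
  prod_symm_conj g k x^-1.
Proof.
move=> [s [<- sg ->]]; exists (rev [seq y^-1 | y <- s]).
split.
- by rewrite size_rev size_map.
- by move=> y; rewrite mem_rev => /mapP[z zs ->]; exact/symm_conjV/sg.
- elim: s {sg} => [|y s IHs]; first by rewrite !big_nil invg1.
  by rewrite big_cons invgM IHs map_cons rev_cons -cats1 big_cat big_seq1.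
Qed.

Lemma prod_symm_conj1 f g : prod_symm_conj g 1 f <-> symm_conj f g.
Proof.
split=> [[s [sz sg ->]]|fg].
  case: s sz sg => [|x [|]]//= _ sg.
  by rewrite big_seq1; apply: sg; rewrite mem_head.
exists [:: f]; split=> //; last by rewrite big_seq1.
by move=> x; rewrite inE => /eqP ->.
Qed.

Lemma prod_symm_conj_trans g f k l h : prod_symm_conj g k f ->
  prod_symm_conj f l h -> prod_symm_conj g (l * k)%N h.
Proof.
move=> gf [s [<- sf ->]]; elim: s sf => [|x s IHs] sf.
  by exists [::]; rewrite !big_nil.
rewrite big_cons mulSn; apply: prod_symm_conjM; last first.
  by apply: IHs => y ys; apply: sf; rewrite inE ys orbT.
have [a [->|->]] := sf x (mem_head _ _); apply: prod_symm_conjJ => //.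
exact: prod_symm_conjV.
Qed.

End SymmConj.

Section Tsuboi.
Variable G : maxNormalGroupType.

Definition outN : Type := set_type (~` (@maxN G)).

HB.instance Definition _ := SubChoice.copy outN (set_type (~` (@maxN G))).

Lemma prod_symm_conj_ex (g : outN) (f : G) :
  exists k, `[< prod_symm_conj (val g) k f >].
Proof.
have [N1 _ maxM] := @maxNP G.
have /set_mem/= gN := valP g.
pose M : set G := [set f | exists k, prod_symm_conj (val g) k f].
suff [k fk] : M f by exists k; exact/asboolP.
suff -> : M = setT by [].
apply: contrapT => MT; apply: gN; apply: (maxM M) => //; last first.
  by exists 1%N; apply/prod_symm_conj1; exact: symm_conj_refl.
split.
- by exists 0%N, [::]; rewrite big_nil.
- by move=> x y [k xk] [l yl]; exists (k + l)%N; exact: prod_symm_conjM.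
- by move=> x [k xk]; exists k; exact: prod_symm_conjV.
- by move=> x y [k xk]; exists k; exact: prod_symm_conjJ.
Qed.

Definition tsuboi_q (g : outN) (f : G) : nat := ex_minn (prod_symm_conj_ex g f).

Lemma tsuboi_qP (g : outN) (f : G) : prod_symm_conj (val g) (tsuboi_q g f) f.
Proof. by rewrite /tsuboi_q; case: ex_minnP => k /asboolP. Qed.

Lemma tsuboi_q_le (g : outN) (f : G) k :
  prod_symm_conj (val g) k f -> (tsuboi_q g f <= k)%N.
Proof.
by move=> gf; rewrite /tsuboi_q; case: ex_minnP => l _; apply; exact/asboolP.
Qed.

Lemma tsuboi_q_gt0 (g f : outN) : (0 < tsuboi_q g (val f))%N.
Proof.
rewrite lt0n; apply/eqP => q0; have := tsuboi_qP g (val f).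
rewrite q0 => -[s [/size0nil -> _ f1]].
have [[N1 _ _ _] _ _] := @maxNP G; have /set_mem := valP f; apply.
by rewrite f1 big_nil.
Qed.

Lemma tsuboi_q_trans (g f h : outN) :
  (tsuboi_q g (val h) <= tsuboi_q g (val f) * tsuboi_q f (val h))%N.
Proof.
apply: tsuboi_q_le; rewrite mulnC.
exact: prod_symm_conj_trans (tsuboi_qP g (val f)) (tsuboi_qP f (val h)).
Qed.

Lemma tsuboi_q1 (g f : outN) : (tsuboi_q g (val f) == 1)%N = `[< symm_conj (val f) (val g) >].
Proof.
apply/eqP/asboolP => [q1|/prod_symm_conj1/tsuboi_q_le].
  by apply/prod_symm_conj1; rewrite -q1; exact: tsuboi_qP.
by move=> q1; apply/eqP; rewrite eqn_leq q1 tsuboi_q_gt0.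
Qed.

Definition symm_conjb (f g : outN) : bool := `[< symm_conj (val f) (val g) >].

Lemma symm_conjb_refl : reflexive symm_conjb.
Proof. by move=> f; apply/asboolP; exact: symm_conj_refl. Qed.

Lemma symm_conjb_sym : symmetric symm_conjb.
Proof. by move=> f g; apply/asboolP/asboolP; exact: symm_conj_sym. Qed.

Lemma symm_conjb_trans : transitive symm_conjb.
Proof.
by move=> g f h /asboolP fg /asboolP gh; apply/asboolP; exact: symm_conj_trans gh.
Qed.

Canonical symm_conj_equiv :=
  EquivRel symm_conjb symm_conjb_refl symm_conjb_sym symm_conjb_trans.

(* [R] is not used in the carrier; it selects where distances take their values. *)
Definition tsuboi (R : realType) : Type := {eq_quot symm_conj_equiv}.

HB.instance Definition _ R := Choice.on (tsuboi R).
HB.instance Definition _ R := EqQuotient.on (tsuboi R).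

Variable R : realType.
Local Open Scope ring_scope.

Definition tsuboi_pdist (f g : outN) : R :=
  ln (maxn (tsuboi_q g (val f)) (tsuboi_q f (val g)))%:R.

Definition tsuboi_dist (x y : tsuboi R) : R := tsuboi_pdist (generic_quotient.repr x) (generic_quotient.repr y).

Lemma tsuboi_pdist_sym f g : tsuboi_pdist f g = tsuboi_pdist g f.
Proof. by rewrite /tsuboi_pdist maxnC. Qed.

Lemma tsuboi_pdist_triangle g f h :
  tsuboi_pdist f h <= tsuboi_pdist f g + tsuboi_pdist g h.
Proof.
have pos (a b : outN) : 0 < (maxn (tsuboi_q a (val b)) (tsuboi_q b (val a)))%:R :> R.
  by rewrite ltr0n leq_max tsuboi_q_gt0.
rewrite /tsuboi_pdist -lnM ?posrE ?pos// ler_ln ?posrE ?mulr_gt0 ?pos//.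
rewrite -natrM ler_nat geq_max; apply/andP; split.
  apply: leq_trans (tsuboi_q_trans h g f) _.
  by rewrite mulnC leq_mul ?leq_maxl.
apply: leq_trans (tsuboi_q_trans f g h) _.
by rewrite leq_mul ?leq_maxr.
Qed.

Lemma tsuboi_pdist_eq0 f g : (tsuboi_pdist f g == 0) = symm_conjb f g.
Proof.
have q0 := tsuboi_q_gt0.
apply/idP/idP => [d0|fg]; last first.
  rewrite /tsuboi_pdist.
  have -> : tsuboi_q g (val f) = 1%N by apply/eqP; rewrite tsuboi_q1.
  have -> : tsuboi_q f (val g) = 1%N.
    by apply/eqP; rewrite tsuboi_q1 -/(symm_conjb g f) symm_conjb_sym.
  by rewrite maxnn ln1.
rewrite /symm_conjb -tsuboi_q1 eqn_leq q0 andbT.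
have : (maxn (tsuboi_q g (val f)) (tsuboi_q f (val g)))%:R <= 1 :> R.
  rewrite -ler_ln ?posrE ?ltr01 ?ltr0n ?leq_max ?q0//.
  by rewrite ln1 -/(tsuboi_pdist f g) (eqP d0).
by rewrite (ler_nat R _ 1) geq_max => /andP[].
Qed.

Let tsuboi_distxx x : tsuboi_dist x x = 0.
Proof. by apply/eqP; rewrite tsuboi_pdist_eq0 symm_conjb_refl. Qed.

Let tsuboi_dist_positivity x y : tsuboi_dist x y = 0 -> x = y.
Proof.
move/eqP; rewrite tsuboi_pdist_eq0 => xy.
by rewrite -[x]reprK -[y]reprK; apply/(@eqmodP _ symm_conj_equiv).
Qed.

Let tsuboi_dist_sym x y : tsuboi_dist x y = tsuboi_dist y x.
Proof. exact: tsuboi_pdist_sym. Qed.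

Let tsuboi_dist_triangle y x z :
  tsuboi_dist x z <= tsuboi_dist x y + tsuboi_dist y z.
Proof. exact: tsuboi_pdist_triangle. Qed.

HB.instance Definition _ := @isMetric.Build R (tsuboi R)
  tsuboi_dist tsuboi_distxx tsuboi_dist_positivity tsuboi_dist_sym
  tsuboi_dist_triangle.

Lemma tsuboi_mdistE (f g : outN) :
  mdist (\pi_(tsuboi R) f) (\pi_(tsuboi R) g) =
  ln (maxn (tsuboi_q g (val f)) (tsuboi_q f (val g)))%:R.
Proof.
have rp (a : outN) : tsuboi_pdist (generic_quotient.repr (\pi_(tsuboi R) a)) a = 0.
  apply/eqP; rewrite tsuboi_pdist_eq0.
  by apply/(@eqmodP _ symm_conj_equiv); rewrite reprK.
have key (a b c : outN) : tsuboi_pdist a b = 0 ->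
    tsuboi_pdist a c = tsuboi_pdist b c.
  move=> ab; apply/eqP; rewrite eq_le; apply/andP; split.
    by apply: le_trans (tsuboi_pdist_triangle b a c) _; rewrite ab add0r.
  apply: le_trans (tsuboi_pdist_triangle a b c) _.
  by rewrite tsuboi_pdist_sym ab add0r.
rewrite -[LHS]/(tsuboi_pdist (generic_quotient.repr _) (generic_quotient.repr _)) (key _ _ _ (rp f)).
by rewrite tsuboi_pdist_sym (key _ _ _ (rp g)) tsuboi_pdist_sym.
Qed.

End Tsuboi.

(* The letters are numbered from 0, as in ['I_n]. *)
Definition perm_ext n (s : 'S_n) (k : nat) : nat :=
  if insub k is Some i then val (s i) else k.

Record Sinf := MkSinf {
  Sinf_fun :> nat -> nat;
  Sinf_funP : exists n (s : 'S_n), Sinf_fun = perm_ext s }.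

Lemma perm_ext_lt n (s : 'S_n) k (kn : (k < n)%N) :
  perm_ext s k = s (Ordinal kn).
Proof. by rewrite /perm_ext insubT. Qed.

Lemma perm_ext_ord n (s : 'S_n) (i : 'I_n) : perm_ext s i = s i.
Proof. by rewrite perm_ext_lt; congr (val (s _)); apply: val_inj. Qed.

Lemma perm_ext_ge n (s : 'S_n) k : (n <= k)%N -> perm_ext s k = k.
Proof. by rewrite leqNgt /perm_ext => kn; rewrite insubF//; exact/negbTE. Qed.

Lemma perm_ext1 n : perm_ext (1 : 'S_n) = id.
Proof.
apply/funext => k; have [nk|kn] := leqP n k; first exact: perm_ext_ge.
by rewrite (perm_ext_lt _ kn) perm1.
Qed.

Lemma perm_extM n (s t : 'S_n) : perm_ext (s * t) = perm_ext t \o perm_ext s.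
Proof.
apply/funext => k /=; have [nk|kn] := leqP n k; first by rewrite !perm_ext_ge.
by rewrite !(perm_ext_lt _ kn) permM perm_ext_ord.
Qed.

Lemma perm_ext_inj n : injective (@perm_ext n).
Proof.
move=> s t st; apply/permP => i; apply: ord_inj.
by rewrite -!perm_ext_ord st.
Qed.

Lemma perm_ext_lift n m (s : 'S_n) : (n <= m)%N ->
  exists2 t : 'S_m, perm_ext t = perm_ext s & odd_perm t = odd_perm s.
Proof.
move=> /subnK <-; elim: (m - n)%N => [|k [t ts od]]; first by exists s.
exists (lift_perm ord_max ord_max t : 'S_(k + n).+1); last first.
  by rewrite odd_lift_perm addbb.
rewrite -ts; apply/funext => i; have [ik|] := ltnP i (k + n); last first.
  move=> ki; rewrite (perm_ext_ge t)//.
  move: ki; rewrite leq_eqVlt => /predU1P[<-|]; last exact: perm_ext_ge.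
  by rewrite -[X in perm_ext _ X]/(val (@ord_max (k + n))) perm_ext_ord
             lift_perm_id.
have -> : i = lift ord_max (Ordinal ik) by rewrite /= /bump leqNgt ik.
by rewrite perm_ext_ord lift_perm_lift !lift_max perm_ext_ord.
Qed.

Lemma Sinf_inj f g : Sinf_fun f = Sinf_fun g -> f = g.
Proof.
case: f g => [f fP] [g gP] /= fg; move: gP; rewrite -fg => gP.
by congr MkSinf; exact: Prop_irrelevance.
Qed.

Definition Sinf_of n (s : 'S_n) : Sinf :=
  MkSinf (ex_intro _ n (ex_intro _ s erefl)).

Lemma Sinf_of_lift n m (s : 'S_n) : (n <= m)%N ->
  exists2 t : 'S_m, Sinf_of t = Sinf_of s & odd_perm t = odd_perm s.
Proof.
by move=> /(perm_ext_lift s)[t ts ot]; exists t => //; exact: Sinf_inj.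
Qed.

Lemma Sinf_ofP_ge (f : Sinf) : exists n0, forall m, (n0 <= m)%N ->
  exists t : 'S_m, f = Sinf_of t.
Proof.
have [n [s fs]] := Sinf_funP f; exists n => m /(Sinf_of_lift s)[t ts _].
by exists t; rewrite ts; exact: Sinf_inj.
Qed.

Lemma Sinf_finsuppP (f : nat -> nat) :
  (bijective f /\ exists n, forall k, (n <= k)%N -> f k = k) <->
  exists n (s : 'S_n), f = perm_ext s.
Proof.
split=> [[/bij_inj fI [n fn]]|[n [s ->]]].
  have lt_f (i : 'I_n) : (f i < n)%N.
    rewrite ltnNge; apply/negP => nf; have /fI fi := fn _ nf.
    by move: nf; rewrite fi leqNgt ltn_ord.
  have sI : injective (fun i => Ordinal (lt_f i)).
    by move=> i j [/fI/val_inj].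
  exists n, (perm sI); apply/funext => k.
  have [nk|kn] := leqP n k; first by rewrite perm_ext_ge ?fn.
  by rewrite (perm_ext_lt _ kn) permE.
split; last by exists n => k; exact: perm_ext_ge.
by exists (perm_ext s^-1) => k; rewrite -[LHS]/((_ \o _) k) -perm_extM
  ?mulgV ?mulVg perm_ext1.
Qed.

HB.instance Definition _ := gen_eqMixin Sinf.
HB.instance Definition _ := gen_choiceMixin Sinf.

Definition Sinf_one : Sinf := Sinf_of (1 : 'S_0).

(* As for finite permutations in MathComp, [f * g] is f followed by g. *)
Fact Sinf_mul_subproof (f g : Sinf) :
  exists n (s : 'S_n), g \o f = perm_ext s.
Proof.
have [n fn] := Sinf_ofP_ge f; have [m gm] := Sinf_ofP_ge g.
have [s ->] := fn _ (leq_maxl n m); have [t ->] := gm _ (leq_maxr n m).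
by exists (maxn n m), (s * t); rewrite perm_extM.
Qed.

Definition Sinf_mul (f g : Sinf) : Sinf := MkSinf (Sinf_mul_subproof f g).

Fact Sinf_inv_subproof (f : Sinf) : exists g : Sinf, cancel f g /\ cancel g f.
Proof.
have [n /(_ n (leqnn n))[s ->]] := Sinf_ofP_ge f.
by exists (Sinf_of s^-1); split=> k /=;
  rewrite -[LHS]/((_ \o _) k) -perm_extM ?mulgV ?mulVg perm_ext1.
Qed.

Definition Sinf_inv (f : Sinf) : Sinf := projT1 (cid (Sinf_inv_subproof f)).

Fact Sinf_mulA : associative Sinf_mul.
Proof. by move=> f g h; exact: Sinf_inj. Qed.

Fact Sinf_mul1g : left_id Sinf_one Sinf_mul.
Proof. by move=> f; apply: Sinf_inj; rewrite /= perm_ext1. Qed.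

Fact Sinf_mulg1 : right_id Sinf_one Sinf_mul.
Proof. by move=> f; apply: Sinf_inj; rewrite /= perm_ext1. Qed.

Fact Sinf_mulVg : left_inverse Sinf_one Sinf_inv Sinf_mul.
Proof.
move=> f; apply: Sinf_inj; apply/funext => k /=; rewrite perm_ext1.
by rewrite /Sinf_inv; case: cid => g [] /= fg gf; exact: gf.
Qed.

Fact Sinf_mulgV : right_inverse Sinf_one Sinf_inv Sinf_mul.
Proof.
move=> f; apply: Sinf_inj; apply/funext => k /=; rewrite perm_ext1.
by rewrite /Sinf_inv; case: cid => g [] /= fg gf; exact: fg.
Qed.

HB.instance Definition _ := isGroup.Build Sinf
  Sinf_mulA Sinf_mul1g Sinf_mulg1 Sinf_mulVg Sinf_mulgV.

Lemma Sinf_of1 n : Sinf_of (1 : 'S_n) = 1.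
Proof. by apply: Sinf_inj; rewrite /= !perm_ext1. Qed.

Lemma Sinf_ofM n : {morph @Sinf_of n : s t / s * t}.
Proof. by move=> s t; apply: Sinf_inj; rewrite /= perm_extM. Qed.

Lemma Sinf_ofV n : {morph @Sinf_of n : s / s^-1}.
Proof.
by move=> s; apply/esym/mulg1_eq; rewrite -Sinf_ofM mulgV Sinf_of1.
Qed.

Lemma Sinf_ofJ n : {morph @Sinf_of n : s t / s ^ t}.
Proof. by move=> s t; rewrite !conjgE !Sinf_ofM Sinf_ofV. Qed.

Lemma Sinf_of_inj n : injective (@Sinf_of n).
Proof. by move=> s t /(congr1 Sinf_fun)/perm_ext_inj. Qed.

Definition Ainf : set Sinf :=
  \bigcup_n [set Sinf_of s | s in [set s : 'S_n | s \in 'Alt_('I_n)]].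

Lemma Ainf_of n (s : 'S_n) : Ainf (Sinf_of s) <-> s \in 'Alt_('I_n).
Proof.
split=> [[m _ [t /= tA ts]]|sA]; last by exists n => //; exists s.
have [s' s's os] := Sinf_of_lift s (leq_maxl n m).
have [t' t't ot] := Sinf_of_lift t (leq_maxr n m).
move: tA; rewrite !Alt_even -os -ot.
by have -> : t' = s' by apply: Sinf_of_inj; rewrite t't s's.
Qed.

Lemma Ainf_normal : normal_subgroup Ainf.
Proof.
split.
- by rewrite -(Sinf_of1 0); apply/Ainf_of; exact: group1.
- move=> f g; have [n fn] := Sinf_ofP_ge f; have [m gm] := Sinf_ofP_ge g.
  have [s ->] := fn _ (leq_maxl n m); have [t ->] := gm _ (leq_maxr n m).
  rewrite -Sinf_ofM => /Ainf_of sA /Ainf_of tA; apply/Ainf_of.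
  exact: groupM.
- move=> f; have [n /(_ n (leqnn n))[s ->]] := Sinf_ofP_ge f.
  by rewrite -Sinf_ofV => /Ainf_of sA; apply/Ainf_of; rewrite groupV.
- move=> f g; have [n fn] := Sinf_ofP_ge f; have [m gm] := Sinf_ofP_ge g.
  have [s ->] := fn _ (leq_maxl n m); have [t ->] := gm _ (leq_maxr n m).
  rewrite -Sinf_ofJ => /Ainf_of sA; apply/Ainf_of.
  by rewrite Alt_even odd_permJ -Alt_even.
Qed.

Lemma Ainf_proper : Ainf <> setT.
Proof.
move=> AT; pose s : 'S_2 := tperm ord0 ord_max.
have : Ainf (Sinf_of s) by rewrite AT.
by move/Ainf_of; rewrite Alt_even odd_tperm.
Qed.

Lemma Alt_sub_normal n (K : {group 'S_n}) (s : 'S_n) : (4 < n)%N ->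
  'Sym_('I_n) \subset 'N(K) -> s \in K -> odd_perm s -> K :=: 'Sym_('I_n).
Proof.
move=> n5 nK sK os.
suff AK : 'Alt_('I_n) \subset K.
  apply/eqP; rewrite finset.eqEsubset finset.subsetT/=; apply/fintype.subsetP => t _.
  have [ot|et] := boolP (odd_perm t); last first.
    by apply: (fintype.subsetP AK); rewrite Alt_even.
  rewrite -(groupMr _ sK); apply: (fintype.subsetP AK).
  by rewrite Alt_even odd_permM ot os.
have /simpleP[_ simA] : simple 'Alt_('I_n).
  by apply: simple_Alt5; rewrite card_ord.
have nKA : fingroup.normal (K :&: 'Alt_('I_n)) 'Alt_('I_n).
  rewrite /normal finset.subsetIr/= normsI ?normG//.
  exact: fintype.subset_trans (finset.subsetT _) nK.
have [KA1|/finset.setIidPr//] := simA _ nKA.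
have comm_s t : [~ s, t] = 1.
  apply/finset.set1P; rewrite -[[set 1]%SET]KA1 inE; apply/andP; split.
    rewrite commgEl groupM ?groupV// memJ_norm//.
    exact: (fintype.subsetP nK).
  by rewrite Alt_even commgEl odd_permM odd_permV odd_permJ addbb.
have [i si] : exists i, s i != i.
  apply: contrapT => /forallNP si; suff s1 : s = 1 by rewrite s1 odd_perm1 in os.
  by apply/permP => i; rewrite perm1; apply/eqP; apply: contra_notT (si i).
have [j] : exists j, j \notin [set i; s i]%SET.
  apply/existsP; rewrite -[X in is_true X]negbK negb_exists; apply/negP => /forallP all_in.
  have : (#|[set: 'I_n]%SET| <= #|[set i; s i]%SET|)%N.
    by apply: subset_leq_card; apply/fintype.subsetP => j _; have := all_in j; rewrite negbK.
  rewrite cardsT card_ord cards2 => n2.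
  by have := leq_trans n5 n2; case: (_ != _).
rewrite !inE negb_or => /andP[ji jsi].
have /eqP/conjg_fixP : [~ tperm i j, s] = 1.
  by rewrite -[LHS]invgK invgR comm_s invg1.
rewrite tpermJ => /permP/(_ (s i)).
have isi : i != s i by rewrite eq_sym.
rewrite tpermL (tpermD isi jsi) => /perm_inj ji'.
by rewrite ji' eqxx in ji.
Qed.

Lemma Ainf_max : max_proper_normal_subgroup Ainf.
Proof.
split; [exact: Ainf_normal|exact: Ainf_proper|].
move=> M [M1 MM MV MJ] MT f Mf; apply: contrapT => fA; apply: MT.
apply/seteqP; split=> // g _.
have [n fn] := Sinf_ofP_ge f; have [m gm] := Sinf_ofP_ge g.
pose p := maxn 5 (maxn n m).
have np : (n <= p)%N by rewrite !leq_max leqnn orbT.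
have mp : (m <= p)%N by rewrite !leq_max leqnn !orbT.
have [s fs] := fn _ np; have [t ->] := gm _ mp.
have os : odd_perm s.
  by apply/negPn/negP => es; apply: fA; rewrite fs; apply/Ainf_of; rewrite Alt_even.
pose K : {set 'S_p} := [set x | `[< M (Sinf_of x) >]]%SET.
have inK x : reflect (M (Sinf_of x)) (x \in K) by rewrite inE; exact: asboolP.
have gK : group_set K.
  apply/group_setP; split; first by apply/inK; rewrite Sinf_of1.
  by move=> x y /inK Mx /inK My; apply/inK; rewrite Sinf_ofM; exact: MM.
have KS : Group gK :=: 'Sym_('I_p).
  apply: (@Alt_sub_normal p _ s) => //=.
  - by rewrite leq_max leqnn.
  - apply/normsP => x _; apply/finset.setP => y; rewrite mem_conjg.
    apply/inK/inK; last by move=> My; rewrite Sinf_ofJ; exact: MJ.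
    by move/(MJ _ (Sinf_of x)); rewrite -Sinf_ofJ conjgKV.
  - by apply/inK; rewrite -fs.
by apply/inK; rewrite -[K]/(gval (Group gK)) KS inE.
Qed.

HB.instance Definition _ := hasMaxNormal.Build Sinf Ainf_max.

Section QuasiIsometry.
Local Open Scope ring_scope.
Variables (R : realType) (X Y : metricType R).

Definition quasi_isometry (F : X -> Y) : Prop :=
  exists A B : R, [/\ 1 <= A, 0 <= B,
    forall x y, A^-1 * mdist x y - B <= mdist (F x) (F y) <= A * mdist x y + B &
    exists C : R, forall z, exists x, mdist (F x) z <= C].

Definition quasi_isometric : Prop := exists F : X -> Y, quasi_isometry F.

End QuasiIsometry.

Section Subspace.
Local Open Scope ring_scope.
Variables (R : realType) (X : metricType R) (A : set X).

Let subspace_dist (x y : A) : R := mdist (set_val x) (set_val y).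

Let subspace_dist_ge0 x y : 0 <= subspace_dist x y.
Proof. exact: mdist_ge0. Qed.

Let subspace_dist_positivity x y : subspace_dist x y = 0 -> x = y.
Proof. by move/mdist_positivity/val_inj. Qed.

Let subspace_ball (x : A) d : ball x d = [set y | subspace_dist x y < d].
Proof. by rewrite -initial_ballE ballEmdist. Qed.

HB.instance Definition _ := @PseudoMetric_isMetric.Build R (A : Type)
  subspace_dist subspace_dist_ge0 subspace_dist_positivity subspace_ball.

End Subspace.

Definition half_line (R : realType) : metricType R :=
  set_type [set x : R^o | (0 <= x)%R].

Lemma half_line_mdistE (R : realType) (x y : half_line R) :
  mdist x y = `|set_val y - set_val x|%R.
Proof. by []. Qed.

(* Main.v *)
Require Import Defs.
From mathcomp Require Import all_boot all_order all_algebra all_fingroup alt.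
From mathcomp Require Import all_classical all_reals all_analysis.
From mathcomp Require Import zify lra.

(** The size of the support is, up to bounded error, the only large-scale
    invariant of an odd finitely supported permutation, and the map
    [[f] |-> ln #supp f] is the quasi-isometry.

    Lower bound. Supports are subadditive under products and their sizes are
    invariant under conjugation and inversion, so [#supp f <= q_g(f) #supp g]
    ([size_supp_prod_symm_conj]); hence [d([f], [g])] is at least
    [|ln #supp f - ln #supp g|].

    Upper bound. If [#supp f <= K #supp g] then [q_g(f) <= 17 + 8 K]
    ([prod_symm_conj_odd]), so that [d([f], [g])] exceeds
    [|ln #supp f - ln #supp g|] by at most [ln 33]. Since [f] and [g] are odd,
    [f g^-1] is even. It is a product of two involutions whose supports lie in
    its own ([perm_mul_involutions]); after multiplying both by one fresh
    transposition if needed, each is a product of an even number of disjoint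
    transpositions ([even_Sinf_mul_swaps]). At least a third of the points of
    [supp g] form a set [t] disjoint from its image [g t]
    ([disjoint_image_subseq]). Commuting [g] with the transpositions that
    exchange points of [t] with points fixed by [g] yields many disjoint
    3-cycles as a product of two conjugates of [g] and [g^-1]
    ([prod_symm_conj_cyc3]), and a product of two such elements consists of
    disjoint double transpositions, any even number up to [2 #t] of
    transpositions being obtained in this way ([prod_symm_conj_swaps_small]).
    The involutions above are cut into [K + 2] such blocks.

    Finally, products of an odd number of disjoint transpositions have support
    sizes [4 m + 2], whose logarithms come within [ln 6] of every point of the
    half line ([log_supp_coarsely_surjective]). *)

Set Implicit Arguments.
Unset Strict Implicit.
Unset Printing Implicit Defensive.

Import Order.TTheory GRing.Theory Num.Theory.

Local Open Scope group_scope.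

(** * Support and parity of a finitely supported permutation *)

Lemma SinfP (f g : Sinf) : f =1 g -> f = g.
Proof. by move=> fg; apply/Sinf_inj/funext. Qed.

Lemma SinfM (f g : Sinf) k : (f * g) k = g (f k).
Proof. by []. Qed.

Lemma Sinf1 k : (1 : Sinf) k = k.
Proof. by rewrite -(Sinf_of1 0) /= perm_ext1. Qed.

Lemma SinfK (f : Sinf) : cancel f (f^-1)%g.
Proof. by move=> k; rewrite -SinfM mulgV Sinf1. Qed.

Lemma SinfKV (f : Sinf) : cancel (f^-1)%g f.
Proof. by move=> k; rewrite -SinfM mulVg Sinf1. Qed.

Lemma Sinf_injective (f : Sinf) : injective f.
Proof. exact: can_inj (SinfK f). Qed.

(** Conjugation relabels the letters; this determines [f ^ h], as [h] is onto. *)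
Lemma SinfJ (f h : Sinf) k : (f ^ h) (h k) = h (f k).
Proof. by rewrite conjgE !SinfM SinfK. Qed.

Lemma Sinf_bound_ex (f : Sinf) : exists n, forall k, (n <= k)%N -> f k = k.
Proof.
have [n /(_ n (leqnn n))[s ->]] := Sinf_ofP_ge f.
by exists n => k; exact: perm_ext_ge.
Qed.

Definition supp_bound (f : Sinf) : nat := projT1 (cid (Sinf_bound_ex f)).

Lemma supp_boundP f k : (supp_bound f <= k)%N -> f k = k.
Proof. exact: (projT2 (cid (Sinf_bound_ex f))). Qed.

Definition supp (f : Sinf) : seq nat := [seq k <- iota 0 (supp_bound f) | f k != k].

Lemma mem_supp f k : (k \in supp f) = (f k != k).
Proof.
rewrite mem_filter mem_iota /= add0n; case: ltnP => [|/supp_boundP ->].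
  by rewrite andbT.
by rewrite eqxx.
Qed.

Lemma supp_uniq f : uniq (supp f).
Proof. exact/filter_uniq/iota_uniq. Qed.

Lemma supp_lt (f : Sinf) k : k \in supp f -> (k < supp_bound f)%N.
Proof. by rewrite mem_supp ltnNge; apply: contra => /supp_boundP ->. Qed.

Lemma mem_suppJ (f : Sinf) k : (f k \in supp f) = (k \in supp f).
Proof. by rewrite !mem_supp (inj_eq (@Sinf_injective f)). Qed.

Lemma size_suppM (f g : Sinf) : (size (supp (f * g)%g) <= size (supp f) + size (supp g))%N.
Proof.
rewrite -size_cat; apply: uniq_leq_size (supp_uniq _) _ => k.
rewrite mem_cat !mem_supp SinfM; apply: contraR.
by rewrite negb_or !negbK => /andP[/eqP -> ].
Qed.

Lemma size_suppV f : size (supp f^-1) = size (supp f).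
Proof.
apply/eqP; rewrite eqn_leq; apply/andP; split;
  apply: uniq_leq_size (supp_uniq _) _ => k; rewrite !mem_supp;
  apply: contra => /eqP {1}<-; by rewrite ?SinfK ?SinfKV.
Qed.

Lemma size_suppJ f h : size (supp (f ^ h)) = size (supp f).
Proof.
rewrite -(size_map h (supp f)); apply: perm_size; apply: uniq_perm.
- exact: supp_uniq.
- by rewrite map_inj_uniq ?supp_uniq//; exact: Sinf_injective.
- move=> k; rewrite -(SinfKV h k) mem_map; last exact: Sinf_injective.
  by rewrite !mem_supp SinfJ (inj_eq (@Sinf_injective h)).
Qed.

(** The lower bound for [q_g(f)]: every factor moves as many letters as [g]. *)
Lemma size_supp_prod_symm_conj g k f :
  prod_symm_conj g k f -> (size (supp f) <= k * size (supp g))%N.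
Proof.
case=> s [<- sg ->]; elim: s sg => [|x s IHs] sg.
  by rewrite big_nil leqn0 size_eq0; apply/eqP/nilP; rewrite /nilp size_filter
     -leqn0 leqNgt -has_count; apply/hasPn => j _; rewrite Sinf1 eqxx.
rewrite big_cons mulSn; apply: leq_trans (size_suppM _ _) _.
apply: leq_add; last by apply: IHs => y ys; apply: sg; rewrite inE ys orbT.
by have [h [->|->]] := sg x (mem_head _ _); rewrite size_suppJ ?size_suppV.
Qed.

Definition odd_Sinf (f : Sinf) : bool := ~~ `[< Ainf f >].

Lemma odd_Sinf_of n (s : 'S_n) : odd_Sinf (Sinf_of s) = odd_perm s.
Proof.
rewrite /odd_Sinf -[RHS]negbK; congr (~~ _); rewrite -Alt_even.
by apply/asboolP/idP => /Ainf_of.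
Qed.

Lemma odd_SinfM f g : odd_Sinf (f * g) = odd_Sinf f (+) odd_Sinf g.
Proof.
have [n fn] := Sinf_ofP_ge f; have [m gm] := Sinf_ofP_ge g.
have [s ->] := fn _ (leq_maxl n m); have [t ->] := gm _ (leq_maxr n m).
by rewrite -Sinf_ofM !odd_Sinf_of odd_permM.
Qed.

Lemma odd_SinfV f : odd_Sinf f^-1 = odd_Sinf f.
Proof.
have : odd_Sinf (f^-1 * f) = false.
  by rewrite mulVg -(Sinf_of1 0) odd_Sinf_of odd_perm1.
by rewrite odd_SinfM; do 2!case: odd_Sinf.
Qed.

Lemma size_supp_gt0 (g : Sinf) : odd_Sinf g -> (0 < size (supp g))%N.
Proof.
move=> og; rewrite lt0n size_eq0; apply: contraTneq og => g0.
suff -> : g = 1 by rewrite -(Sinf_of1 0) odd_Sinf_of odd_perm1.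
by apply: SinfP => k; apply/eqP; rewrite Sinf1 -[_ == _]negbK -mem_supp g0.
Qed.

(** * Products of disjoint transpositions *)

Definition transp (a b : nat) : Sinf :=
  Sinf_of (tperm (inord a : 'I_(maxn a b).+1) (inord b)).

Lemma transpE a b k : transp a b k = if k == a then b else if k == b then a else k.
Proof.
have an : (a < (maxn a b).+1)%N by rewrite ltnS leq_maxl.
have bn : (b < (maxn a b).+1)%N by rewrite ltnS leq_maxr.
have [kn|nk] := ltnP k (maxn a b).+1.
  rewrite /transp /= (perm_ext_lt _ kn) permE /=.
  rewrite -!val_eqE /= !inordK//.
  by case: ifP => _; [rewrite inordK|case: ifP => _ //; rewrite inordK].
rewrite /transp /= perm_ext_ge//.
by rewrite !gtn_eqF ?(leq_trans _ nk).
Qed.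

Lemma odd_transp a b : odd_Sinf (transp a b) = (a != b).
Proof.
rewrite odd_Sinf_of odd_tperm -val_eqE /= !inordK//.
  by rewrite ltnS leq_maxr.
by rewrite ltnS leq_maxl.
Qed.

Lemma transpC a b : transp a b = transp b a.
Proof.
by apply: SinfP => k; rewrite !transpE; case: eqP => [->|_]; case: eqP => // ->.
Qed.

Lemma transpV a b : (transp a b)^-1 = transp a b.
Proof.
apply/mulg1_eq/SinfP => k; rewrite SinfM Sinf1 !transpE.
by case: (k =P a) => [->|ka]; [|case: (k =P b) => [->|kb]]; do ?case: eqP => //; congruence.
Qed.

Lemma transpJ a b h : transp a b ^ h = transp (h a) (h b).
Proof.
apply: SinfP => k; rewrite -(SinfKV h k) SinfJ !transpE !(inj_eq (@Sinf_injective h)).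
by do 2?case: ifP.
Qed.

(** Extending a partial matching letter by letter: a transposition corrects the
    image of the new letter without disturbing the previous ones. Hence two elements
    given by the same expression in duplicate-free lists of letters of the same
    length are conjugate. *)
Lemma Sinf_map_ex (u v : seq nat) : uniq u -> uniq v -> size u = size v ->
  exists h : Sinf, map h u = v.
Proof.
elim: u v => [|x u IHu] [|y v] //=; first by exists 1.
move=> /andP[xu uu] /andP[yv vv] [/(IHu _ uu vv)[h hu]].
have hxv : h x \notin v by rewrite -hu mem_map//; exact: Sinf_injective.
exists (h * transp (h x) y); rewrite SinfM transpE eqxx; congr (_ :: _).
have -> : [seq (h * transp (h x) y) i | i <- u] = map (transp (h x) y) v.
  by rewrite -hu -map_comp.
rewrite -[RHS]map_id; apply/eq_in_map => k kv.
rewrite transpE; case: eqP => [kE|_]; first by rewrite -kE kv in hxv.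
by case: eqP => // kE; rewrite -kE kv in yv.
Qed.

Definition swaps (p : seq (nat * nat)) : Sinf := \prod_(x <- p) transp x.1 x.2.

Definition disjoint_pairs (p : seq (nat * nat)) : bool := uniq (unzip1 p ++ unzip2 p).

Lemma swaps_cons x p : swaps (x :: p) = transp x.1 x.2 * swaps p.
Proof. exact: big_cons. Qed.

Lemma swaps_cat p q : swaps (p ++ q) = swaps p * swaps q.
Proof. exact: big_cat. Qed.

Lemma swapsV p : (swaps p)^-1 = swaps (rev p).
Proof.
elim: p => [|x p IHp]; first by rewrite /swaps !big_nil invg1.
by rewrite swaps_cons invgM IHp transpV rev_cons -cats1 swaps_cat /swaps big_seq1.
Qed.

Lemma swapsJ p h : swaps p ^ h = swaps [seq (h x.1, h x.2) | x <- p].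
Proof.
by rewrite /swaps conjg_prod big_map; apply: eq_bigr => x _; rewrite transpJ.
Qed.

Lemma swaps_zipJ u v h : swaps (zip u v) ^ h = swaps (zip (map h u) (map h v)).
Proof.
by rewrite swapsJ; congr swaps; elim: u v => [|x u IHu] [|y v] //=; rewrite IHu.
Qed.

Lemma swaps_zipC u v : swaps (zip u v) = swaps (zip v u).
Proof.
elim: u v => [|x u IHu] [|y v]; rewrite //= ?zip0s ?zips0//.
by rewrite !swaps_cons /= transpC IHu.
Qed.

Lemma swaps_id p k : k \notin unzip1 p ++ unzip2 p -> swaps p k = k.
Proof.
elim: p => [|[x y] p IHp]; first by rewrite /swaps big_nil Sinf1.
rewrite /= inE mem_cat inE !negb_or => /and4P[kx kp ky kq].
rewrite swaps_cons SinfM transpE /= (negbTE kx) (negbTE ky) IHp//.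
by rewrite mem_cat negb_or kp.
Qed.

Lemma disjoint_pairs_cons x y p : disjoint_pairs ((x, y) :: p) =
  [&& x != y, x \notin unzip1 p ++ unzip2 p, y \notin unzip1 p ++ unzip2 p & disjoint_pairs p].
Proof.
rewrite /disjoint_pairs /= -cat1s uniq_catCA /= !mem_cat !inE !negb_or.
by case: (x == y); case: (x \in _); case: (x \in _); case: (y \in _); case: (y \in _);
  rewrite /= ?andbF.
Qed.

Lemma swapsE p x y : disjoint_pairs p -> (x, y) \in p -> swaps p x = y /\ swaps p y = x.
Proof.
elim: p => [//|[a b] p IHp]; rewrite disjoint_pairs_cons => /and4P[ab ap bp dp].
rewrite swaps_cons !SinfM !transpE /= inE => /predU1P[[-> ->]|xy].
  by rewrite !eqxx eq_sym (negbTE ab) !swaps_id.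
have inp z : z \in unzip1 p ++ unzip2 p -> (z != a) && (z != b).
  by move=> zp; apply/andP; split; [apply: contraNneq ap|apply: contraNneq bp] => <-.
have /andP[/negbTE -> /negbTE ->] : (x != a) && (x != b).
  by apply: inp; rewrite mem_cat (map_f fst xy).
have /andP[/negbTE -> /negbTE ->] : (y != a) && (y != b).
  by apply: inp; rewrite mem_cat (map_f snd xy) orbT.
exact: IHp.
Qed.

Lemma odd_swaps p : disjoint_pairs p -> odd_Sinf (swaps p) = odd (size p).
Proof.
elim: p => [|[a b] p IHp]; first by rewrite /swaps big_nil -(Sinf_of1 0) odd_Sinf_of odd_perm1.
by rewrite disjoint_pairs_cons swaps_cons odd_SinfM odd_transp /= => /and4P[-> _ _ /IHp ->].
Qed.

Lemma size_supp_swaps p : disjoint_pairs p -> size (supp (swaps p)) = (2 * size p)%N.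
Proof.
move=> dp; rewrite -[RHS]/(2 * _)%N mul2n -addnn -{1}(size_map fst p) -(size_map snd p) -size_cat.
apply: perm_size; apply: (uniq_perm (supp_uniq _) dp) => k.
rewrite mem_supp; apply/idP/idP => [|kp]; first by apply: contraR => /swaps_id ->.
have := dp; rewrite /disjoint_pairs cat_uniq => /and3P[_ /hasPn d12 _].
move: kp; rewrite mem_cat => /orP[] /mapP[[x y] xy ->];
  have [xE yE] := swapsE dp xy; rewrite /= ?xE ?yE.
  by apply: contraNneq (d12 _ (map_f snd xy)) => /= ->; exact: (map_f fst xy).
by apply: contraNneq (d12 _ (map_f snd xy)) => /= <-; exact: (map_f fst xy).
Qed.

(** * Decomposition into involutions *)

(** On each orbit choose a base point [r x]. The reflection [a], which sends
    [s^i r] to [s^-i r], and [a * s], which sends [s^i r] to [s^(1 - i) r], are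
    both involutions: a cycle is a rotation of a polygon, hence a product of two
    reflections. *)
Lemma perm_mul_involutions (T : finType) (s : {perm T}) :
  exists a b : {perm T}, [/\ s = a * b, a * a = 1, b * b = 1 &
    forall x, s x = x -> a x = x /\ b x = x].
Proof.
have sI := @perm_inj _ s.
have sC : connect_sym (frel s) by exact: (fconnect_sym sI).
pose r := froot s.
have iterE c : c \in <[s]> -> exists n, forall x, c x = iter n s x.
  by case/cycleP => n ->; exists n => x; rewrite permX.
have rc c x : c \in <[s]> -> r (c x) = r x.
  case/iterE => n ->; apply/esym/eqP; rewrite root_connect//; exact: fconnect_iter.
have ex x : exists c, (c \in <[s]>) && (c (r x) == x).
  exists (s ^+ findex s (r x) x); rewrite mem_cycle permX iter_findex ?eqxx//.
  by rewrite sC connect_root.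
pose c x := xchoose (ex x).
have /all_and2[cs cr] : forall x, c x \in <[s]> /\ c x (r x) = x.
  by move=> x; have /andP[? /eqP] := xchooseP (ex x).
pose a0 x := (c x)^-1 (r x).
(* Which power of [s] carries the base point to a given point does not matter,
   since the powers of [s] commute. *)
have a0E x d : d \in <[s]> -> r x = x -> a0 (d x) = d^-1 x.
  move=> ds rx; rewrite /a0 rc// rx.
  have := cr (d x); rewrite rc// rx; move: (c _) (cs (d x)) => e es ex'.
  have ed : d * e^-1 = e^-1 * d.
    by apply: (centsP (cycle_abelian s)); rewrite ?groupV.
  by rewrite -[in RHS](permK e x) ex' -!permM ?mulgA ed -mulgA mulgV mulg1.
have rr x : r (r x) = r x by exact: root_root.
have a0K : involutive a0.
  by move=> x; rewrite {2}/a0 a0E ?groupV// invgK cr.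
pose a := perm (inv_inj a0K).
have aa : a * a = 1 by apply/permP => x; rewrite permM !permE a0K.
have fixa x : s x = x -> a0 x = x.
  move=> sx; rewrite -[X in a0 X = _]cr a0E// -[in RHS](cr x).
  have := cr x; have /iterE[n ->] := cs x.
  have /iterE[m mE] : (c x)^-1 \in <[s]> by rewrite groupV.
  have fix_iter k : iter k s x = x by elim: k => //= k ->.
  have rx : r x = x.
    have /iter_findex <- : fconnect s x (r x) by exact: connect_root.
    exact: fix_iter.
  by rewrite mE rx fix_iter.
exists a, (a * s); split.
- by rewrite mulgA aa mul1g.
- exact: aa.
- apply/permP => x; rewrite !permM perm1 !permE -/r -[in LHS](cr x) (a0E (r x) (c x))//.
  rewrite -(permM (c x)^-1 s) (a0E _ _ _ (rr x)) ?groupM ?groupV ?cycle_id//.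
  rewrite invgM invgK -permM.
  have -> : s^-1 * c x = c x * s^-1.
    by apply: (centsP (cycle_abelian s)); rewrite ?groupV ?cycle_id.
  by rewrite mulgVK cr.
- by move=> x sx; rewrite permM permE fixa.
Qed.

(** Each 2-cycle is listed once, from its smaller element. *)
Lemma involution_swaps (a : Sinf) : a * a = 1 ->
  exists p, [/\ disjoint_pairs p, a = swaps p & {subset unzip1 p ++ unzip2 p <= supp a}].
Proof.
move=> aa; have aK k : a (a k) = k by rewrite -SinfM aa Sinf1.
pose s := [seq k <- supp a | (k < a k)%N].
pose p := [seq (k, a k) | k <- s].
have p1 : unzip1 p = s by rewrite /p /unzip1 -map_comp map_id.
have p2 : unzip2 p = map a s by rewrite /p /unzip2 -map_comp.
have us : uniq s by rewrite filter_uniq ?supp_uniq.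
have dp : disjoint_pairs p.
  rewrite /disjoint_pairs p1 p2 cat_uniq us map_inj_uniq ?us ?andbT /=;
    last exact: Sinf_injective.
  apply/hasPn => _ /mapP[k + ->]; rewrite !mem_filter aK => /andP[k1 _].
  by rewrite ltnNge ltnW.
exists p; split=> //.
- apply: SinfP => k; have [ak|ka|ka] := ltngtP k (a k).
  + have kp : (k, a k) \in p.
      by apply: map_f; rewrite mem_filter ak mem_supp gtn_eqF.
    by have [-> _] := swapsE dp kp.
  + have kp : (a k, k) \in p.
      rewrite -[in X in (_, X)](aK k); apply: map_f.
      by rewrite mem_filter aK ka mem_supp aK gtn_eqF.
    by have [_ ->] := swapsE dp kp.
  + rewrite -ka swaps_id// p1 p2 mem_cat negb_or mem_filter -ka ltnn /=.
    apply/mapP => -[j]; rewrite mem_filter => /andP[ja _] kj.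
    by move: ka; rewrite kj aK => ka; rewrite ka ltnn in ja.
- move=> k; rewrite p1 p2 mem_cat => /orP[|/mapP[j + ->]].
    by rewrite mem_filter => /andP[].
  rewrite mem_filter !mem_supp aK eq_sym; by case/andP.
Qed.

Lemma Sinf_mul_involutions (f : Sinf) : exists a b : Sinf,
  [/\ f = a * b, a * a = 1, b * b = 1 &
      {subset supp a <= supp f} /\ {subset supp b <= supp f}].
Proof.
have [n /(_ n (leqnn n))[s fs]] := Sinf_ofP_ge f; subst f.
have [a [b [sab aa bb fix_ab]]] := perm_mul_involutions s.
exists (Sinf_of a), (Sinf_of b); rewrite -!Sinf_ofM -sab aa bb Sinf_of1.
split=> //.
have fix_n k : perm_ext s k = k -> perm_ext a k = k /\ perm_ext b k = k.
  have [kn|nk] := ltnP k n; last by rewrite !perm_ext_ge.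
  rewrite !(perm_ext_lt _ kn) => sk.
  have /fix_ab[-> ->] // : s (Ordinal kn) = Ordinal kn by exact: val_inj.
by split=> k; rewrite !mem_supp; apply: contra => /eqP /fix_n [] /= ak bk; apply/eqP.
Qed.

(** * Generation by few conjugates *)

(** Greedy selection: a chosen letter [x] excludes only itself, [g x] and
    [g^-1 x], whence the factor 3. *)
Lemma disjoint_image_subseq (g : Sinf) (s : seq nat) :
  uniq s -> (forall k, k \in s -> g k != k) ->
  exists t, [/\ {subset t <= s}, uniq (map g t ++ t) & (size s <= 3 * size t)%N].
Proof.
have [n] := ubnP (size s); elim: n s => // n IHn [|x s] /=; first by exists [::].
rewrite ltnS => sn /andP[xs us] gs.
pose s' := [seq k <- s | k \notin [:: g x; g^-1 x]].
have s's : {subset s' <= s} by move=> k; rewrite mem_filter => /andP[].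
have [||k ks'|t [ts' ut s't]] := IHn s'.
- by rewrite size_filter (leq_ltn_trans (count_size _ _)).
- exact: filter_uniq.
- by apply: gs; rewrite inE s's ?orbT.
exists (x :: t); split.
- move=> k; rewrite !inE => /predU1P[->|/ts'/s's ->]; last by rewrite orbT.
  by rewrite eqxx.
- have xt : x \notin t by apply: contra xs => /ts'/s's.
  have gxt : g x \notin t.
    by apply/negP => /ts'; rewrite mem_filter !inE eqxx.
  have xgt : x \notin map g t.
    apply/mapP => -[k /ts' + xk]; rewrite mem_filter !inE xk SinfK eqxx.
    by rewrite orbT.
  have gxgt : g x \notin map g t by rewrite mem_map//; exact: Sinf_injective.
  rewrite /= -[x :: t]cat1s uniq_catCA /= !mem_cat !inE !negb_or.
  by rewrite gxgt gxt xgt xt ut gs ?mem_head.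
- have := count_predC [in [:: g x; g^-1 x]] s; rewrite -[count (predC _) s]size_filter => <-.
  have : (count [in [:: g x; (g^-1)%g x]] s <= 2)%N.
    rewrite -size_filter; apply: (@uniq_leq_size _ _ [:: g x; g^-1 x]).
      exact: filter_uniq.
    by move=> k; rewrite mem_filter => /andP[].
  rewrite /s' in s't; move: s't; move: (size _) (count _ _) => c1 c2 /=; lia.
Qed.

(** For duplicate-free [a ++ b ++ y] this is the product of the disjoint
    3-cycles [a_i -> b_i -> y_i -> a_i]. Written with two blocks of
    transpositions it is visibly of the form [s ^ g * s^-1], and in products of
    such elements whole blocks cancel. *)
Definition cyc3 (a b y : seq nat) : Sinf := swaps (zip a y) * (swaps (zip b y))^-1.

(** Let [s] exchange part of [t] with letters outside the support of [g]. Then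
    [s ^ g] exchanges the images under [g] with the same letters, so
    [g^-1 * g ^ s^-1 = s ^ g * s^-1] has the shape [cyc3]. All elements of this
    shape and size are conjugate. *)
Lemma prod_symm_conj_cyc3 (g : Sinf) (t a b y : seq nat) :
  {subset t <= supp g} -> uniq (map g t ++ t) -> (size a <= size t)%N ->
  size b = size a -> size y = size a -> uniq (a ++ b ++ y) ->
  prod_symm_conj g 2 (cyc3 a b y).
Proof.
move=> tg ut at_ ba ya uaby.
pose t' := take (size a) t; pose ys := iota (supp_bound g) (size a).
have st' : size t' = size a by rewrite size_takel.
have gys : map g ys = ys.
  rewrite -[RHS]map_id; apply/eq_in_map => k; rewrite mem_iota => /andP[kg _].
  exact: supp_boundP.
have lt_t' k : k \in t' -> (k < supp_bound g)%N by move=> /mem_take/tg/supp_lt.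
have uz : uniq (map g t' ++ t' ++ ys).
  rewrite catA cat_uniq iota_uniq andbT; apply/andP; split.
    move: ut; rewrite !cat_uniq !map_inj_uniq; try exact: Sinf_injective.
    case/and3P => ut /hasPn nt _; rewrite take_uniq//= andbT.
    apply/hasPn => k /mem_take/nt; apply: contra.
    by move=> /mapP[j /mem_take jt ->]; exact: map_f.
  apply/hasPn => k; rewrite mem_iota => /andP[gk _]; apply/negP.
  rewrite /= mem_cat => /orP[/mapP[j /mem_take/tg jg kj]|/lt_t'].
    by move: gk; rewrite leqNgt kj supp_lt// mem_suppJ.
  by rewrite ltnNge gk.
have [|h] := Sinf_map_ex uz uaby.
  by rewrite !size_cat size_map size_iota st' ba ya.
rewrite !map_cat => /eqP; rewrite eqseq_cat ?size_map// => /andP[/eqP ha].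
rewrite eqseq_cat ?size_map ?st'// => /andP[/eqP hb /eqP hy].
pose s := swaps (zip t' ys).
suff -> : cyc3 a b y = (g^-1 * g ^ s^-1) ^ h.
  apply: prod_symm_conjJ; apply: (@prod_symm_conjM _ g 1 1); apply/prod_symm_conj1.
    exact/symm_conjV/symm_conj_refl.
  exact/symm_conjJ/symm_conj_refl.
have -> : g^-1 * g ^ s^-1 = s ^ g * s^-1 by rewrite !conjgE invgK !mulgA.
by rewrite swaps_zipJ gys conjMg conjVg !swaps_zipJ ha hb hy.
Qed.

(** The letterwise identity [(a y)(b z) = (a y)(b y) . (y b)(z b)] writes a double
    transposition as a product of two 3-cycles; it is applied to the two halves
    of [p] simultaneously. *)
Lemma prod_symm_conj_swaps_small (g : Sinf) (t : seq nat) p :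
  {subset t <= supp g} -> uniq (map g t ++ t) ->
  disjoint_pairs p -> ~~ odd (size p) -> (size p <= 2 * size t)%N ->
  prod_symm_conj g 4 (swaps p).
Proof.
move=> tg ut dp ep pt.
pose k := (size p)./2; have pk : size p = (k + k)%N by rewrite addnn halfK (negbTE ep) subn0.
(* The second half is reversed because [cyc3 y z b] contains the inverse of its
   second block, and inverting a product reverses the order of the factors. *)
pose p1 := take k p; pose p2 := rev (drop k p).
have s1 : size p1 = k by rewrite size_takel ?pk ?leq_addr.
have s2 : size p2 = k by rewrite size_rev size_drop pk addnK.
pose a := unzip1 p1; pose y := unzip2 p1; pose z := unzip1 p2; pose b := unzip2 p2.
have [sa sy sz sb] : [/\ size a = k, size y = k, size z = k & size b = k].
  by rewrite !size_map s1 s2.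
have pe : perm_eq (unzip1 p ++ unzip2 p) ((a ++ z) ++ (y ++ b)).
  rewrite -[p](cat_take_drop k) /unzip1 /unzip2 !map_cat.
  rewrite perm_cat// perm_cat2l /z /b /p2 /unzip1 /unzip2 map_rev perm_sym perm_rev//.
have ub : uniq ((a ++ z) ++ (y ++ b)) by rewrite -(perm_uniq pe).
have uaby : uniq (a ++ b ++ y).
  apply: subseq_uniq (_ : subseq _ ((a ++ b ++ y) ++ z)) _; first exact: prefix_subseq.
  rewrite (perm_uniq (_ : perm_eq _ ((a ++ z) ++ (y ++ b))))//.
  by apply/seq.permP => q; rewrite !count_cat; lia.
have uyzb : uniq (y ++ z ++ b).
  apply: subseq_uniq (_ : subseq _ ((y ++ z ++ b) ++ a)) _; first exact: prefix_subseq.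
  rewrite (perm_uniq (_ : perm_eq _ ((a ++ z) ++ (y ++ b))))//.
  by apply/seq.permP => q; rewrite !count_cat; lia.
have kt : (k <= size t)%N by move: pt; rewrite pk; lia.
have -> : swaps p = cyc3 a b y * cyc3 y z b.
  rewrite /cyc3 mulgA -[_ * _^-1 * _]mulgA (swaps_zipC y b) mulVg mulg1.
  by rewrite !zip_unzip swapsV revK -swaps_cat cat_take_drop.
by apply: (@prod_symm_conjM _ g 2 2); apply: (prod_symm_conj_cyc3 tg ut);
   rewrite ?sa ?sy ?sz ?sb.
Qed.

(** Blocks of [2 * size t] transpositions, the last one possibly shorter or even
    empty: since every block costs exactly 4 factors, so does each of the [N]
    steps. *)
Lemma prod_symm_conj_swaps (g : Sinf) (t : seq nat) p N :
  {subset t <= supp g} -> uniq (map g t ++ t) ->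
  disjoint_pairs p -> ~~ odd (size p) -> (size p <= N * (2 * size t))%N ->
  prod_symm_conj g (N * 4) (swaps p).
Proof.
move=> tg ut; elim: N p => [|N IHN] p dp ep pN.
  have /size0nil -> : size p = 0%N by lia.
  by exists [::]; rewrite /swaps !big_nil.
set c := (2 * size t)%N in pN.
have pe : perm_eq (unzip1 p ++ unzip2 p)
    ((unzip1 (take c p) ++ unzip2 (take c p)) ++ (unzip1 (drop c p) ++ unzip2 (drop c p))).
  rewrite -{1 2}[p](cat_take_drop c) /unzip1 /unzip2 !map_cat.
  by apply/seq.permP => q; rewrite !count_cat; lia.
move: dp; rewrite /disjoint_pairs (perm_uniq pe) cat_uniq => /and3P[d1 _ d2].
rewrite -[p](cat_take_drop c) swaps_cat mulSn; apply: prod_symm_conjM.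
  apply: (prod_symm_conj_swaps_small tg ut d1); last by rewrite size_take; case: ifP; lia.
  by rewrite size_take; case: ifP => // _; rewrite /c oddM.
by apply: (IHN _ d2); rewrite size_drop; lia.
Qed.

(** The two involutions have the same parity. If both are odd, inserting the
    square of a transposition of two letters beyond the support of [u] between
    them makes both even; this accounts for the summand 2. *)
Lemma even_Sinf_mul_swaps (u : Sinf) : ~~ odd_Sinf u ->
  exists p q, [/\ u = swaps p * swaps q, disjoint_pairs p /\ disjoint_pairs q,
    ~~ odd (size p) /\ ~~ odd (size q) &
    (2 * size p <= size (supp u) + 2)%N /\ (2 * size q <= size (supp u) + 2)%N].
Proof.
move=> eu; have [a [b [uE aa bb [sa sb]]]] := Sinf_mul_involutions u.
have [p [dp ap pa]] := involution_swaps aa; have [q [dq bq qb]] := involution_swaps bb.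
have le_u r (c : Sinf) : disjoint_pairs r -> {subset unzip1 r ++ unzip2 r <= supp c} ->
    {subset supp c <= supp u} -> (2 * size r <= size (supp u))%N.
  move=> dr rc cu; apply: leq_trans (uniq_leq_size dr (fun k kr => cu _ (rc _ kr))).
  by rewrite size_cat !size_map mul2n addnn.
have := le_u _ _ dp pa sa; have := le_u _ _ dq qb sb => lq lp.
move: eu; rewrite {1}uE odd_SinfM {1}ap {1}bq !odd_swaps// => epq.
have [op|ep] := boolP (odd (size p)); last first.
  by exists p, q; rewrite -ap -bq (negbTE ep) /= in epq *; split=> //; split=> //; lia.
have oq : odd (size q) by rewrite op in epq; rewrite -[odd _]negbK.
pose n := supp_bound u.
have disj_fresh r (c : Sinf) : disjoint_pairs r -> {subset unzip1 r ++ unzip2 r <= supp c} ->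
    {subset supp c <= supp u} -> disjoint_pairs ((n, n.+1) :: r).
  move=> dr rc cu; rewrite disjoint_pairs_cons dr andbT neq_ltn leqnn /=.
  by apply/andP; split; apply/negP => /rc/cu/supp_lt; rewrite /n; lia.
exists (rcons p (n, n.+1)), ((n, n.+1) :: q).
split; last by rewrite size_rcons /=; lia.
- rewrite uE ap bq -cats1 swaps_cat [swaps [:: _]]big_seq1 swaps_cons mulgA.
  by rewrite -[swaps p * _ * _]mulgA -{1}transpV mulVg mulg1.
- split; last exact: disj_fresh qb sb.
  have := disj_fresh _ _ dp pa sa; rewrite /disjoint_pairs /unzip1 /unzip2 !map_rcons.
  rewrite (perm_uniq (_ : perm_eq _ (rcons (map fst p) n ++ rcons (map snd p) n.+1)))//.
  apply/seq.permP => r; rewrite -!cats1 /= !count_cat /= ?count_cat /=.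
  lia.
- by rewrite size_rcons /= op oq.
Qed.

(** The upper bound for [q_g(f)]. A factor [g] is split off from [f] because only
    even products of transpositions are generated blockwise. *)
Lemma prod_symm_conj_odd (f g : Sinf) K : odd_Sinf f -> odd_Sinf g ->
  (size (supp f) <= K * size (supp g))%N ->
  exists2 n, prod_symm_conj g n f & (n <= 17 + 8 * K)%N.
Proof.
move=> of_ og fg.
have [t [tg ut gt_]] := @disjoint_image_subseq g _ (supp_uniq g)
  (fun k => etrans (esym (mem_supp g k))).
have [|p [q [fgE [dp dq] [ep eq_] [lp lq]]]] := @even_Sinf_mul_swaps (f * g^-1).
  by rewrite odd_SinfM odd_SinfV of_ og.
have lfg := size_suppM f g^-1; rewrite size_suppV in lfg.
have g0 := size_supp_gt0 og.
have t0 : (0 < size t)%N by lia.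
(* With [m], [n] the support sizes of [f], [g] and [r] the size of [t], one has
   [2 j <= m + n + 2 <= (K + 1) (3 r) + 2 r <= 4 (K + 2) r]. *)
have le_t (j : nat) : (2 * j <= size (supp (f * g^-1)%g) + 2)%N ->
  (j <= (K + 2) * (2 * size t))%N by nia.
have pP := prod_symm_conj_swaps tg ut dp ep (le_t _ lp).
have qP := prod_symm_conj_swaps tg ut dq eq_ (le_t _ lq).
exists ((K + 2) * 4 + (K + 2) * 4 + 1)%N; last by lia.
rewrite -[f](mulgKV g) fgE; apply: prod_symm_conjM; last first.
  exact/prod_symm_conj1/symm_conj_refl.
exact: prod_symm_conjM.
Qed.

(** * The logarithm of the support size as a quasi-isometry *)

Lemma odd_outN (g : outN Sinf) : odd_Sinf (val g).
Proof. by apply/asboolPn; have := valP g; rewrite inE. Qed.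

Lemma outN_of_odd (f : Sinf) : odd_Sinf f -> exists g : outN Sinf, val g = f.
Proof.
move=> of_; have fN : f \in (~` @maxN Sinf)%classic by rewrite inE; exact/asboolPn.
by exists (exist _ f fN).
Qed.

Lemma size_supp_tsuboi_q (g f : outN Sinf) :
  (size (supp (val f)) <= tsuboi_q g (val f) * size (supp (val g)))%N.
Proof. exact/size_supp_prod_symm_conj/tsuboi_qP. Qed.

Lemma tsuboi_q_size_supp (g f : outN Sinf) K :
  (size (supp (val f)) <= K * size (supp (val g)))%N ->
  (tsuboi_q g (val f) <= 17 + 8 * K)%N.
Proof.
move=> /(prod_symm_conj_odd (odd_outN f) (odd_outN g))[n fn nK].
exact: leq_trans (tsuboi_q_le fn) nK.
Qed.

Section LogSupport.
Variable R : realType.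
Local Open Scope ring_scope.

Definition log_supp (f : Sinf) : R := ln (size (supp f))%:R.

Lemma log_supp_ge0 (f : outN Sinf) : 0 <= log_supp (val f).
Proof. by rewrite ln_ge0// ler1n size_supp_gt0// odd_outN. Qed.

Lemma log_supp_tsuboi_q (f g : outN Sinf) :
  log_supp (val f) - log_supp (val g) <= ln (tsuboi_q g (val f))%:R.
Proof.
have sp (h : outN Sinf) : (size (supp (val h)))%:R \is @Num.pos R.
  by rewrite posrE ltr0n size_supp_gt0// odd_outN.
have qp : (tsuboi_q g (val f))%:R \is @Num.pos R by rewrite posrE ltr0n tsuboi_q_gt0.
rewrite lerBlDr -lnM// ler_ln ?rpredM//.
by rewrite -natrM ler_nat size_supp_tsuboi_q.
Qed.

Lemma log_supp_le_pdist (f g : outN Sinf) :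
  `|log_supp (val f) - log_supp (val g)| <= tsuboi_pdist R f g.
Proof.
have le_max (h k : outN Sinf) :
    ln (tsuboi_q h (val k))%:R <= tsuboi_pdist R k h.
  rewrite /tsuboi_pdist ler_ln ?posrE ?ltr0n ?leq_max ?tsuboi_q_gt0//.
  by rewrite ler_nat leq_maxl.
rewrite ler_norml lerNl opprB !(le_trans (log_supp_tsuboi_q _ _))//.
by rewrite (tsuboi_pdist_sym R f) le_max.
Qed.

(** With [d] the integer quotient of the larger support size by the smaller,
    the two numbers [q] are at most [17 + 8] and [17 + 8 (d + 1)], both bounded by
    [33 d] because [1 <= d]. *)
Lemma pdist_le_log_supp (f g : outN Sinf) :
  tsuboi_pdist R f g <= `|log_supp (val f) - log_supp (val g)| + ln 33%:R.
Proof.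
wlog fg : f g / (size (supp (val f)) <= size (supp (val g)))%N.
  move=> H; have [/H//|/ltnW/H] := leqP (size (supp (val f))) (size (supp (val g))).
  by rewrite tsuboi_pdist_sym distrC.
have f0 : (0 < size (supp (val f)))%N by rewrite size_supp_gt0// odd_outN.
have g0 : (0 < size (supp (val g)))%N by rewrite size_supp_gt0// odd_outN.
pose d := (size (supp (val g)) %/ size (supp (val f)))%N.
have d0 : (0 < d)%N by rewrite divn_gt0.
have qgf : (tsuboi_q g (val f) <= 33 * d)%N.
  by apply: leq_trans (tsuboi_q_size_supp (K := 1) _) _; rewrite ?mul1n//; lia.
have qfg : (tsuboi_q f (val g) <= 33 * d)%N.
  apply: leq_trans (tsuboi_q_size_supp (K := d.+1) _) _; last lia.
  by rewrite ltnW// ltn_ceil.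
have qd : tsuboi_pdist R f g <= ln (33 * d)%:R.
  rewrite /tsuboi_pdist ler_ln ?posrE ?ltr0n ?leq_max ?tsuboi_q_gt0 ?muln_gt0//.
  by rewrite ler_nat geq_max qgf.
apply: le_trans qd _; rewrite natrM lnM ?posrE ?ltr0n// addrC lerD2r.
rewrite distrC; apply: le_trans (ler_norm _).
rewrite lerBrDr -lnM ?posrE ?ltr0n// ler_ln ?posrE ?ltr0n ?mulr_gt0 ?ltr0n//.
by rewrite -natrM ler_nat leq_divM.
Qed.

(** With [m] the integral part of [exp z], the number [2 m + 1] of disjoint
    transpositions is odd and the support size [4 m + 2] lies between [exp z] and
    [6 exp z]. *)
Lemma log_supp_coarsely_surjective (z : R) : 0 <= z ->
  exists f : outN Sinf, `|log_supp (val f) - z| <= ln 6%:R.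
Proof.
move=> z0; pose m := Num.truncn (expR z).
have e1 : 1 <= expR z by rewrite -expR0 ler_expR.
have /andP[m1 m2] := truncn_itv (le_trans ler01 e1).
pose n := m.*2.+1; pose p := zip (iota 0 n) (iota n n).
have sp : size p = n by rewrite size_zip !size_iota minnn.
have dp : disjoint_pairs p.
  by rewrite /disjoint_pairs unzip1_zip ?unzip2_zip ?size_iota// -iotaD iota_uniq.
have [|f fE] := @outN_of_odd (swaps p); first by rewrite odd_swaps// sp /n /= odd_double.
exists f; rewrite /log_supp fE size_supp_swaps// sp.
have -> : z = ln (expR z) by rewrite expRK.
have n0 : 0 < (2 * n)%:R :> R by rewrite ltr0n.
have e0 := expR_gt0 z.
have l1 : expR z <= (2 * n)%:R.
  by apply/ltW/(lt_le_trans m2); rewrite ler_nat /n -/m; lia.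
have l2 : (2 * n)%:R <= 6%:R * expR z.
  have : (2 * n)%:R = 4%:R * m%:R + 2%:R :> R.
    by rewrite -natrM -natrD; congr (_%:R); rewrite /n; lia.
  by move=> ->; lra.
rewrite ler_norml lerNl opprB !lerBlDr -!lnM ?posrE ?ltr0n// !ler_ln ?posrE ?mulr_gt0//.
rewrite l2 andbT; apply: le_trans l1 _; lra.
Qed.

End LogSupport.

Theorem theorem1p17 (R : realType) :
  quasi_isometric (tsuboi Sinf R) (half_line R).
Proof.
pose F (x : tsuboi Sinf R) : half_line R :=
  exist _ (log_supp R (val (generic_quotient.repr x)))
    (mem_set (log_supp_ge0 R (generic_quotient.repr x))).
have FE x y : mdist (F x) (F y) =
    `|log_supp R (val (generic_quotient.repr x)) -
      log_supp R (val (generic_quotient.repr y))|%R.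
  by rewrite half_line_mdistE distrC.
exists F, 1%R, (ln 33%:R); split.
- by [].
- by rewrite ln_ge0// ler1n.
- move=> x y; rewrite FE invr1 !mul1r lerBlDr pdist_le_log_supp /=.
  by rewrite ler_wpDr ?log_supp_le_pdist// ln_ge0// ler1n.
exists (ln 6%:R)%R => -[z zP].
have [f fz] := log_supp_coarsely_surjective (set_mem zP).
exists (\pi_(tsuboi Sinf R) f)%qT; rewrite half_line_mdistE /= distrC.
(* The class of [f] is represented by some element at distance 0 from [f], and
   the lower bound makes [log_supp] agree on the two. *)
suff : log_supp R (val (generic_quotient.repr (\pi_(tsuboi Sinf R) f)%qT)) = log_supp R (val f).
  by move=> fE; rewrite -fE in fz.
apply/eqP; rewrite -subr_eq0 -normr_le0.
apply: le_trans (log_supp_le_pdist _ _ _) _.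
rewrite -[X in (X <= _)%R]tsuboi_mdistE reprK mdistxx.
by [].
Qed.
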